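(* If $(X,d)$ is a metric space with $|X|>1$, then $C_{(X,d)}\geq 2$.
   Context: For a metric space $(X,d)$, write $B(x,r)=\{y\in X: d(x,y)<r\}$ for $x\in X$, $r>0$. All measures $\mu$ on $X$ considered are Borel regular and non-trivial in the sense that $0<\mu(B(x,r))<\infty$ for every $x\in X$ and $r>0$. Such a $\mu$ is called doubling if there is a constant $C\ge 1$ with $\mu(B(x,2r))\le C\mu(B(x,r))$ for all $x\in X$, $r>0$; in that case $C_\mu=\sup_{x\in X,\,r>0}\frac{\mu(B(x,2r))}{\mu(B(x,r))}$. The least doubling constant of $(X,d)$ is $C_{(X,d)}=\inf\{C_\mu:\mu\text{ doubling measure on }(X,d)\}$, with $C_{(X,d)}=\infty$ if no doubling measure exists on $(X,d)$. *)

(* Defs.v *)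
From HB Require Import structures.
From mathcomp Require Import all_boot all_order all_algebra.
From mathcomp Require Import all_classical all_reals all_analysis.

Set Implicit Arguments.
Unset Strict Implicit.
Unset Printing Implicit Defensive.

Import Order.TTheory GRing.Theory Num.Theory.

Local Open Scope classical_set_scope.
Local Open Scope ring_scope.
Local Open Scope ereal_scope.

Definition borel_sets (X : topologicalType) : set (set X) :=
  <<s [set A : set X | open A] >>.
Arguments borel_sets X : clear implicits.

(* "Borel regular" is a notion about measures defined on all subsets, i.e.
   outer measures (as in Federer or Heinonen). *)
Definition borel_regular (R : realType) (X : topologicalType)
    (mu : {outer_measure set X -> \bar R}) : Prop :=
  borel_sets X `<=` mu.-caratheodory /\
  forall A : set X, exists B : set X,
    [/\ borel_sets X B, A `<=` B & mu B = mu A].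

Definition nontrivial (R : realType) (X : metricType R)
    (mu : {outer_measure set X -> \bar R}) : Prop :=
  forall (x : X) (r : R), (0 < r)%R -> 0 < mu (ball x r) < +oo.

Definition doubling (R : realType) (X : metricType R)
    (mu : {outer_measure set X -> \bar R}) : Prop :=
  exists C : R, (1 <= C)%R /\
    forall (x : X) (r : R), (0 < r)%R ->
      mu (ball x (2 * r)%R) <= C%:E * mu (ball x r).

Definition doubling_measures (R : realType) (X : metricType R) :
    set {outer_measure set X -> \bar R} :=
  [set mu | [/\ borel_regular mu, nontrivial mu & doubling mu]].
Arguments doubling_measures {R} X.

Definition doubling_constant (R : realType) (X : metricType R)
    (mu : {outer_measure set X -> \bar R}) : \bar R :=
  ereal_sup [set mu (ball p.1 (2 * p.2)%R) / mu (ball p.1 p.2)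
            | p in [set p : X * R | (0 < p.2)%R]].

(* When there is no doubling measure this is [ereal_inf set0 = +oo]. *)
Definition least_doubling_constant (R : realType) (X : metricType R) : \bar R :=
  ereal_inf [set doubling_constant mu | mu in doubling_measures X].

(* Main.v *)
Require Import Defs.
From mathcomp Require Import all_boot all_order all_algebra.
From mathcomp Require Import all_classical all_reals all_analysis.
From mathcomp Require Import ring lra.

(** Suppose a measure, written [m], satisfies [m (ball x (2r)) <= C * m (ball x r)]
    with [C < 2].

    If the space splits into two nonempty pieces at distance [g > 0], take [a]
    and [b] in different pieces with [e := d(a,b) - g] very small. For
    [t <= g] the balls of radius [t] about [a] and [b] are disjoint and
    [ball a (2t)] contains both [ball a t] and [ball b (2t - d(a,b))], so the
    sum [S] of the masses of the two balls satisfies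
    [S (2t - d(a,b)) <= (C - 1) * S t]. Iterating from [t = g] yields
    [S (g/2) <= (C - 1)^k * S g] with [k] as large as we like when [e] is
    small, whereas [S g <= C * S (g/2)].

    If it does not split, then for [d(x,y) = D] every annulus about [x] of
    inner radius at most [D] and positive thickness is inhabited, so
    [ball x (2D)] contains [2^k] disjoint balls of radius about [D / 2^k], each
    of mass at least a constant times [C^-k] times that of [ball x (2D)]. *)

Set Implicit Arguments.
Unset Strict Implicit.
Unset Printing Implicit Defensive.

Import Order.TTheory GRing.Theory Num.Theory.
Local Open Scope classical_set_scope.
Local Open Scope ring_scope.

Lemma geometric_lt1 (R : realType) (q K : R) : 0 <= q -> q < 1 ->
  exists k : nat, K * q ^+ k < 1.
Proof.
move=> q0 q1; have qn : `|q| < 1 by rewrite ger0_norm.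
have K0 : 0 < (`|K| + 1)^-1 by rewrite invr_gt0 ltr_wpDl.
have /cvgrPdist_lt/(_ _ K0) [k _ /(_ k (leqnn k))] := cvg_expr qn.
rewrite /= sub0r normrN ger0_norm ?exprn_ge0// => qk; exists k.
apply: (@le_lt_trans _ _ ((`|K| + 1) * q ^+ k)).
  by rewrite ler_wpM2r ?exprn_ge0// (le_trans (ler_norm K))// lerDl.
by rewrite mulrC -ltr_pdivlMr ?ltr_wpDl// mul1r.
Qed.

Section BallGrowth.
Variables (R : realType) (X : metricType R).
Local Notation dist := (@mdist R X).

Lemma mem_ballE (x w : X) (r : R) : ball x r w <-> dist x w < r.
Proof. by rewrite ballEmdist. Qed.

Lemma subset_ball (x y : X) (r s : R) :
  dist x y + r <= s -> ball y r `<=` ball x s.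
Proof.
move=> h w /mem_ballE yw; apply/mem_ballE; have := metric_triangle x y w; lra.
Qed.

(** [m x r] abstracts the real-valued mass of [ball x r], so that the metric argument stays in
    [R]. *)
Variables (m : X -> R -> R) (C : R).
Hypothesis m_gt0 : forall x r, 0 < r -> 0 < m x r.
Hypothesis m_le : forall x y r s, 0 < r -> 0 < s ->
  ball x r `<=` ball y s -> m x r <= m y s.
Hypothesis m_disjoint : forall x y z r s t, 0 < r -> 0 < s -> 0 < t ->
  ball x r `&` ball y s = set0 -> ball x r `<=` ball z t ->
  ball y s `<=` ball z t -> m x r + m y s <= m z t.
Hypothesis m_double : forall x r, 0 < r -> m x (2 * r) <= C * m x r.

Lemma m_homo (x : X) (r s : R) : 0 < r -> r <= s -> m x r <= m x s.
Proof.
move=> r0 rs; apply: m_le => //; first exact: lt_le_trans rs.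
by apply: subset_ball; rewrite mdistxx; lra.
Qed.

Lemma doubling_ge1 (x : X) : 1 <= C.
Proof.
have m1 := m_gt0 x (@ltr01 R).
have m12 : m x 1 <= m x (2 * 1) by apply: m_homo => //; lra.
rewrite -(ler_pM2r m1) mul1r; by apply: le_trans m12 (m_double _ _).
Qed.

Lemma m_double_iter (x : X) (r : R) (k : nat) : 0 < r ->
  m x (2 ^+ k * r) <= C ^+ k * m x r.
Proof.
move=> r0; elim: k => [|k IH]; first by rewrite !expr0 !mul1r.
rewrite exprS -mulrA (le_trans (m_double _ _)) ?mulr_gt0 ?exprn_gt0//.
by rewrite exprS -mulrA ler_wpM2l// (le_trans ler01)// (doubling_ge1 x).
Qed.

Lemma gap_step (a b : X) (g t : R) :
  ball a g `&` ball b g = set0 -> g <= dist a b -> t <= g ->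
  0 < 2 * t - dist a b ->
  m a (2 * t - dist a b) + m b (2 * t - dist a b) <=
  (C - 1) * (m a t + m b t).
Proof.
move=> ab0 gd tg u0; have t0 : 0 < t by have := mdist_ge0 a b; lra.
have half (x y : X) : ball x g `&` ball y g = set0 -> g <= dist x y ->
    0 < 2 * t - dist x y -> m y (2 * t - dist x y) <= (C - 1) * m x t.
  move=> xy0 gxy xy; have := m_double x t0.
  have : m x t + m y (2 * t - dist x y) <= m x (2 * t).
    apply: m_disjoint => //; first by rewrite mulr_gt0.
    - rewrite -subset0 -xy0; apply: setISS; apply: subset_ball;
        rewrite mdistxx; lra.
    - by apply: subset_ball; rewrite mdistxx; lra.
    - by apply: subset_ball; lra.
  lra.
have := half a b ab0 gd u0.
have := half b a; rewrite setIC metric_sym => /(_ ab0 gd u0).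
lra.
Qed.

(** The map t ↦ 2t - d(a,b) doubles the distance to its fixed point d(a,b); the radius here is its
    k-th iterate from [g]. *)
Lemma gap_iter (a b : X) (g : R) (k : nat) :
  ball a g `&` ball b g = set0 -> g <= dist a b ->
  0 < g - (2 ^+ k - 1) * (dist a b - g) ->
  m a (g - (2 ^+ k - 1) * (dist a b - g)) +
    m b (g - (2 ^+ k - 1) * (dist a b - g)) <=
  (C - 1) ^+ k * (m a g + m b g).
Proof.
move=> ab0 gd; elim: k => [|k IH]; first by rewrite !expr0 subrr mul0r subr0 mul1r.
have -> : g - (2 ^+ k.+1 - 1) * (dist a b - g) =
    2 * (g - (2 ^+ k - 1) * (dist a b - g)) - dist a b.
  by rewrite exprS; ring.
set t := g - _ in IH *; move=> u0.
have tg : t <= g.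
  by rewrite gerBl mulr_ge0 ?subr_ge0// exprn_ege1// ler1n.
have t0 : 0 < t by have := mdist_ge0 a b; lra.
apply: le_trans (gap_step ab0 gd tg u0) _.
rewrite exprS -mulrA ler_wpM2l ?IH// subr_ge0; exact: doubling_ge1 a.
Qed.

Lemma gap_ge2 (P : set X) (delta : R) : 0 < delta -> P !=set0 -> ~` P !=set0 ->
  (forall a b, P a -> ~ P b -> delta <= dist a b) -> 2 <= C.
Proof.
move=> delta0 [a0 Pa0] [b0 Pb0] Pdelta; rewrite leNgt; apply/negP => C2.
pose D := [set r | exists a b, [/\ P a, ~ P b & r = dist a b]].
have D0 : D !=set0 by exists (dist a0 b0), a0, b0.
have lbD : lbound D delta by move=> _ [a [b [Pa Pb ->]]]; exact: Pdelta.
have infD : has_inf D by split=> //; exists delta.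
pose g := inf D.
have g0 : 0 < g by apply: (lt_le_trans delta0); exact: lb_le_inf.
have gle a b : P a -> ~ P b -> g <= dist a b.
  by move=> Pa Pb; apply: (ge_inf infD.2); exists a, b.
have C1 := doubling_ge1 a0.
have [k Ck] : exists k : nat, C * (C - 1) ^+ k < 1.
  by apply: geometric_lt1; lra.
(* Taking d(a,b) - g below this tolerance keeps the radius at least g/2 through [k] steps. *)
have e0 : 0 < g / 2 ^+ k.+1 by rewrite divr_gt0// exprn_gt0.
have [_ [a [b [Pa Pb ->]]] abe] := inf_adherent e0 infD.
have gab := gle a b Pa Pb.
(* A common point would be closer than [g] to whichever of [a], [b] lies in the other piece. *)
have ab0 : ball a g `&` ball b g = set0.
  rewrite -subset0 => z [/mem_ballE az /mem_ballE bz].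
  have [Pz|Pz] := pselect (P z).
    by have := gle z b Pz Pb; rewrite metric_sym; lra.
  by have := gle a z Pa Pz; lra.
pose t := g - (2 ^+ k - 1) * (dist a b - g).
have tg : g / 2 <= t.
  have : 2 ^+ k * (dist a b - g) <= g / 2.
    have -> : g / 2 = 2 ^+ k * (g / 2 ^+ k.+1).
      by rewrite exprS; field; rewrite expf_neq0.
    by rewrite ler_pM2l ?exprn_gt0// lerBlDl ltW.
  by rewrite /t; lra.
have g20 : 0 < g / 2 by rewrite divr_gt0.
have t0 : 0 < t := lt_le_trans g20 tg.
have := gap_iter ab0 gab t0; rewrite -/t => St.
have double x : m x g <= C * m x t.
  have -> : m x g = m x (2 * (g / 2)) by congr m; field.
  by apply: le_trans (m_double x g20) _; rewrite ler_wpM2l ?m_homo//; lra.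
have : m a g + m b g <= C * (C - 1) ^+ k * (m a g + m b g).
  apply: (@le_trans _ _ (C * (m a t + m b t))).
    by rewrite mulrDr lerD.
  rewrite -mulrA ler_wpM2l//; lra.
have S0 : 0 < m a g + m b g by rewrite addr_gt0// m_gt0.
by rewrite leNgt gtr_pMl// Ck.
Qed.

Lemma annuli_ge2 (x y : X) : 0 < dist x y ->
  (forall s t, 0 < s -> s < t -> s <= dist x y ->
     exists z, s <= dist x z <= t) -> 2 <= C.
Proof.
set D := dist x y => D0 annulus; rewrite leNgt; apply/negP => C2.
have C1 := doubling_ge1 x.
(* Equivalently C^(k+4) < 2^k: 2^k balls outweigh the loss from k+4 doublings. *)
have [k Ck] : exists k : nat, C ^+ 4 * (C / 2) ^+ k < 1.
  by apply: geometric_lt1; lra.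
have p0 : 0 < 2 ^+ k :> R by rewrite exprn_gt0.
pose d := D / (3 * 2 ^+ k).
have d0 : 0 < d by rewrite divr_gt0// mulr_gt0.
have Dd : D = 3 * 2 ^+ k * d by rewrite /d; field; rewrite gt_eqF.
(* For z within D of x, [ball z (2 ^+ (k + 4) * d)] has radius 16D/3 >= 3D, hence contains
   [ball x (2 * D)]; k+3 doublings would reach only 8D/3. *)
pose c := m x (2 * D) / C ^+ (k + 4).
have Cp0 : 0 < C ^+ (k + 4) by rewrite exprn_gt0//; lra.
have cle z : dist x z <= D -> c <= m z d.
  move=> xz; rewrite /c ler_pdivrMr// [leRHS]mulrC.
  apply: le_trans (m_double_iter z (k + 4) d0).
  apply: m_le; rewrite ?mulr_gt0 ?exprn_gt0//.
  apply: subset_ball; rewrite metric_sym exprD; move: Dd; lra.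
(* Each new ball of radius [d] uses up 3d of radius: its centre lies between (3j+2)d and (3j+3)d
   from [x], so it misses radius (3j+1)d and stays inside (3j+4)d. *)
have grow (j : nat) : (j <= 2 ^ k)%N -> j%:R * c <= m x ((3 * j%:R + 1) * d).
  elim: j => [_|j IH jk].
    by rewrite mul0r ltW// m_gt0// mulr_gt0//; lra.
  have jk' : j%:R + 1 <= 2 ^+ k :> R by rewrite natr1 -natrX ler_nat.
  have j0 : 0 <= j%:R :> R by [].
  have jd : (j%:R + 1) * d <= 2 ^+ k * d by rewrite ler_pM2r.
  have jd0 : 0 <= j%:R * d by rewrite mulr_ge0// ltW.
  have [||| z /andP[z1 z2]] := annulus ((3 * j%:R + 2) * d) ((3 * j%:R + 3) * d).
  - by lra.
  - by lra.
  - by rewrite -/D; lra.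
  have cz : c <= m z d by apply: cle; lra.
  have : m x ((3 * j%:R + 1) * d) + m z d <= m x ((3 * j.+1%:R + 1) * d).
    rewrite -natr1; apply: m_disjoint => //; [lra|lra| | |].
    - rewrite -subset0 => w [/mem_ballE xw /mem_ballE zw].
      by have := metric_triangle x w z; rewrite (metric_sym w z); lra.
    - by apply: subset_ball; rewrite mdistxx; lra.
    - by apply: subset_ball; lra.
  have := IH (ltnW jk); rewrite -natr1 mulrDl mul1r; lra.
have := grow (2 ^ k)%N (leqnn _); rewrite natrX => grown.
have : 2 ^+ k * c <= m x (2 * D).
  apply: (le_trans grown); apply: m_homo; first by rewrite mulr_gt0//; lra.
  have : 1 * d <= 2 ^+ k * d by rewrite ler_pM2r// exprn_ege1// ler1n.
  by move: Dd; lra.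
have M0 : 0 < m x (2 * D) by rewrite m_gt0// mulr_gt0.
rewrite /c mulrCA ger_pMr// ler_pdivrMr// mul1r.
move: Ck; rewrite expr_div_n mulrA -exprD addnC ltr_pdivrMr// mul1r; lra.
Qed.

Lemma doubling_ge2 (x y : X) : x <> y -> 2 <= C.
Proof.
move=> /eqP; rewrite -mdist_gt0 => xy0.
have [annulus|] := pselect (forall s t, 0 < s -> s < t -> s <= dist x y ->
  exists z, s <= dist x z <= t); first exact: (annuli_ge2 xy0).
move=> /existsNP[s /existsNP[t]]; rewrite !not_implyE => -[s0 [st [sxy noz]]].
have far z : s <= dist x z -> t < dist x z.
  by move=> sz; rewrite ltNge; apply/negP => zt; apply: noz; exists z; rewrite sz.
(* An empty annulus separates the ball of radius [s], which contains [x], from its complement, which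
   contains [y]. *)
apply: (@gap_ge2 [set z | dist x z < s] (t - s)); first by rewrite subr_gt0.
- by exists x; rewrite /= mdistxx.
- by exists y => /=; rewrite ltNge sxy.
- move=> a b /= xa /negP; rewrite -leNgt => /far xb.
  by have := metric_triangle x a b; lra.
Qed.

End BallGrowth.

Lemma borel_ball (R : realType) (X : metricType R) (x : X) (r : R) :
  borel_sets X (ball x r).
Proof.
apply: sub_gen_smallest => /=; rewrite openE => y /mem_ballE xy.
apply/nbhs_ballP; exists (r - mdist x y); first by rewrite /= subr_gt0.
by apply: subset_ball; lra.
Qed.

Lemma doubling_constant_ge2 (R : realType) (X : metricType R)
    (mu : {outer_measure set X -> \bar R}) (x y : X) :
  x <> y -> borel_regular mu -> nontrivial mu ->
  (2%:E <= doubling_constant mu)%E.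
Proof.
move=> xy [borel_mu _] mu_fin.
have muE z r : 0 < r -> mu (ball z r) = (fine (mu (ball z r)))%:E.
  by move=> r0; rewrite fineK// ge0_fin_numE ?outer_measure_ge0//;
    have /andP[] := mu_fin z r r0.
have m_gt0 z r : 0 < r -> 0 < fine (mu (ball z r)).
  by move=> r0; rewrite fine_gt0// mu_fin.
have ratio z r : 0 < r ->
    ((fine (mu (ball z (2 * r))) / fine (mu (ball z r)))%:E <=
      doubling_constant mu)%E.
  move=> r0; apply: ereal_sup_ubound; exists (z, r) => //=.
  by rewrite (muE z r)// (muE z (2 * r)) ?mulr_gt0//= inver gt_eqF ?m_gt0.
(* A finite supremum is itself a doubling constant; -oo is excluded because a real ratio lies below
   it. *)
case E: (doubling_constant mu) => [C| |]; last 2 first.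
- by rewrite leey.
- by have := ratio x 1 ltr01; rewrite E.
rewrite lee_fin.
apply: (@doubling_ge2 R X (fun z r => fine (mu (ball z r))) C _ _ _ _ x y xy).
- exact: m_gt0.
- move=> u v r s r0 s0 uv; rewrite -lee_fin -!muE//; exact: le_outer_measure.
- move=> u v w r s t r0 s0 t0 uv0 uw vw.
  rewrite -lee_fin EFinD -!muE//.
  (* Carathéodory's criterion for [ball u r] cuts [ball w t] in two; [ball v s] lies in the outer
     part. *)
  rewrite (borel_mu _ (borel_ball u r) (ball w t)).
  apply: leeD; apply: le_outer_measure => p; first by move=> up; split => //; exact: uw.
  move=> vp; split; first exact: vw.
  by move=> up; have : (ball u r `&` ball v s) p by []; rewrite uv0.
- move=> u r r0; rewrite -ler_pdivrMr ?m_gt0//.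
  by have := ratio u r r0; rewrite E lee_fin.
Qed.

Theorem theorem3p1 (R : realType) (X : metricType R)
    (cardX : exists x y : X, x <> y) :
  (2%:E <= least_doubling_constant X)%E.
Proof.
case: cardX => x [y xy]; apply/ereal_infP => _ [mu [reg fin _] <-].
exact: doubling_constant_ge2 xy reg fin.
Qed.
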